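(* A graph $G$ is $12$-representable by a $111$-avoiding word if and only if $G$ is $12$-representable.
   Context: All graphs are finite, simple and undirected. Let $[n]=\{1,\ldots,n\}$. For a word $w$ over positive integers, $\mathrm{red}(w)$ is the word obtained from $w$ by replacing each occurrence of the $i$th smallest letter with $i$. For a word (pattern) $p=p_1\cdots p_k$ with $\mathrm{red}(p)=p$, a word $w=w_1\cdots w_\ell$ contains $p$ if there are indices $i_1<\cdots<i_k$ with $\mathrm{red}(w_{i_1}\cdots w_{i_k})=p$; otherwise $w$ avoids $p$ (is $p$-avoiding). A labeled graph with vertex set $[n]$ is $12$-represented by a word $w$ over $[n]$ containing at least one copy of each letter of $[n]$ if for all $i<j$ in $[n]$: $i$ and $j$ are adjacent if and only if every occurrence of $j$ precedes every occurrence of $i$ in $w$. An (unlabeled) graph on $n$ vertices is $12$-representable (resp. $12$-representable by a $p$-avoiding word) if its vertices can be labeled bijectively by $[n]$ so that the resulting labeled graph is $12$-represented by some word (resp. by some $p$-avoiding word). *)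

(* Defs.v *)
From mathcomp Require Import all_boot all_order.

Set Implicit Arguments.
Unset Strict Implicit.
Unset Printing Implicit Defensive.

Definition red (w : seq nat) : seq nat :=
  [seq (index x (sort leq (undup w))).+1 | x <- w].

Definition contains (p w : seq nat) : Prop :=
  exists2 s : seq nat, subseq s w & red s = p.

Definition avoids (p w : seq nat) : Prop := ~ contains p w.

(* The set [n] = {1, ..., n} is encoded by 'I_n, the ordinal i standing for
   the letter i + 1; this recovers the word over positive integers. *)
Definition letters n (w : seq 'I_n) : seq nat := [seq i.+1 | i : 'I_n <- w].

(* onth w a = Some j says that a is (the position of) an occurrence of j. *)
Definition represents12 n (g : rel 'I_n) (w : seq 'I_n) : Prop :=
  (forall i : 'I_n, i \in w) /\
  forall i j : 'I_n, i < j ->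
    (g i j <->
     forall a b : nat, onth w a = Some j -> onth w b = Some i -> a < b).

(* A labeling is given as the bijection v sending each label to the vertex
   carrying it, so relpre v e is the resulting labeled graph. *)
Definition representable12 (T : finType) (e : rel T) : Prop :=
  exists2 v : 'I_#|T| -> T, bijective v &
    exists w : seq 'I_#|T|, represents12 (relpre v e) w.

Definition representable12_avoiding (p : seq nat) (T : finType) (e : rel T)
    : Prop :=
  exists2 v : 'I_#|T| -> T, bijective v &
    exists2 w : seq 'I_#|T|, represents12 (relpre v e) w &
      avoids p (letters w).

(* Main.v *)
Require Import Defs.
From mathcomp Require Import all_boot all_order.

(** For distinct letters [i] and [j], every [j] in a word precedes every [i]
    exactly when [i j] is not a subsequence of it ([precedesE]).  So the represented graph depends
    only on which letters occur and on which pairs of distinct letters are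
    subsequences.  If a letter [x] occurs three times, deleting a middle
    occurrence changes neither: wherever it served in a pair [x j] the earlier
    [x] serves as well, and in a pair [i x] the later one does
    ([subseq2_delete_middle]).  Deleting middle occurrences as long as there
    are some ends, because the word shrinks, with a word having at most two
    copies of each letter, and such a word avoids 111 ([contains_111]). *)

Section Words.

Variable T : eqType.
Implicit Types (x i j : T) (s u v w : seq T).

Lemma subseq_cons_split x s w :
  subseq (x :: s) w -> exists u v, w = u ++ x :: v /\ subseq s v.
Proof.
elim: w => [//|y w IHw] /=; case: eqP => [<- sw|_ /IHw [u [v [-> sv]]]].
  by exists [::], w.
by exists (y :: u), v.
Qed.

Lemma subseq2_memr i j w : subseq [:: i; j] w -> j \in w.
Proof. by move/mem_subseq; apply; rewrite !inE eqxx orbT. Qed.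

Lemma subseq2_cat i j u v :
  subseq [:: i; j] (u ++ v) =
    [|| subseq [:: i; j] u, subseq [:: i; j] v | (i \in u) && (j \in v)].
Proof.
elim: u => [|y u IHu]; first by rewrite orbF.
rewrite /= in_cons.
case: (eqVneq i y) => [_|_]; last exact: IHu.
rewrite !sub1seq mem_cat /=.
by case: (boolP (subseq _ v)) => [/subseq2_memr->|_]; rewrite ?orbT.
Qed.

(** In a pair that uses the deleted [x], the copy of [x] in [u] can replace it
    as first letter, and the copy in [v] as second letter. *)
Lemma subseq2_delete_middle i j x u v :
  x \in u -> x \in v ->
  subseq [:: i; j] (u ++ x :: v) = subseq [:: i; j] (u ++ v).
Proof.
move=> xu xv; rewrite !subseq2_cat in_cons /=.
have -> : (j == x) || (j \in v) = (j \in v) by case: eqP => // ->.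
case: (eqVneq i x) => [->|//]; rewrite sub1seq xu /=.
case: (boolP (subseq [:: x; j] v)) => [/subseq2_memr->|_] //=.
by rewrite orbb.
Qed.

Lemma mem_delete_middle x u v : x \in v -> u ++ x :: v =i u ++ v.
Proof.
by move=> xv y; rewrite !mem_cat in_cons; case: eqP => // ->; rewrite xv.
Qed.

Lemma precedesE i j w : i != j ->
  (forall a b, onth w a = Some j -> onth w b = Some i -> a < b) <->
  ~~ subseq [:: i; j] w.
Proof.
move=> ij; split=> [prec|Nsub a b wa wb].
  apply/negP => /subseq_cons_split[u [t [def_w]]].
  rewrite sub1seq => jt; suff: size u + (index j t).+1 < size u.
    by rewrite ltnNge leq_addr.
  have jt_size : index j t < size t by rewrite index_mem.
  apply: prec; rewrite def_w onth_cat; last by rewrite ltnn subnn.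
  rewrite ltnNge leq_addr addKn /= onthE (nth_map j) //.
  by rewrite nth_index.
have lt_aw : a < size w by rewrite -onthTE wa.
rewrite ltnNge; apply: contra Nsub; rewrite leq_eqVlt => /predU1P[eq_ba|lt_ba].
  by move: ij; rewrite eq_ba wa in wb; case: wb => ->; rewrite eqxx.
have i_take : i \in take a w.
  rewrite -[X in X \in _](onth_nth i _ _ _ wb) -(nth_take i lt_ba) mem_nth //.
  by rewrite size_takel // ltnW.
have j_drop : j \in drop a w.
  by rewrite (drop_nth j lt_aw) (onth_nth j _ _ _ wa) mem_head.
by rewrite -(cat_take_drop a w) subseq2_cat i_take j_drop !orbT.
Qed.

End Words.

(** Three letters reduce to 111 only if they are equal, because the rank of a
    letter in a word determines the letter. *)
Lemma contains_111 n (w : seq 'I_n) :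
  contains [:: 1; 1; 1] (letters w) -> exists x, subseq [:: x; x; x] w.
Proof.
case=> s /subseqP[m _ ->]; rewrite /letters -map_mask.
have: subseq (mask m w) w by exact: mask_subseq.
case: (mask m w) => [|p [|q [|r [|//]]]] // sub_w.
rewrite /red; set t := [seq i.+1 | i : 'I_n <- [:: p; q; r]].
have rank_inj y z : y \in t -> index y (sort leq (undup t)) = 0 ->
    z \in t -> index z (sort leq (undup t)) = 0 -> y = z.
  move=> yt y0 zt z0.
  have mem_sorted c : c \in t -> c \in sort leq (undup t).
    by rewrite mem_sort mem_undup.
  by rewrite -(nth_index 0 (mem_sorted _ yt)) y0 -z0 nth_index ?mem_sorted.
case=> p0 q0 r0.
have [pt qt rt] : [/\ p.+1 \in t, q.+1 \in t & r.+1 \in t].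
  by rewrite !inE !eqxx !orbT.
have /eq_add_S/val_inj pq := rank_inj _ _ pt p0 qt q0.
have /eq_add_S/val_inj pr := rank_inj _ _ pt p0 rt r0.
by exists p; move: sub_w; rewrite -pq -pr.
Qed.

Lemma represents12_delete_middle n (g : rel 'I_n) x (u v : seq 'I_n) :
  x \in u -> x \in v ->
  represents12 g (u ++ x :: v) -> represents12 g (u ++ v).
Proof.
move=> xu xv [all_w adj_w]; split=> [i|i j ltij].
  by rewrite -(mem_delete_middle _ _ _ _ xv).
have ij : i != j by rewrite -val_eqE neq_ltn ltij.
apply: (iff_trans (adj_w _ _ ltij)); apply: (iff_trans (precedesE _ _ _ _ ij)).
rewrite subseq2_delete_middle //.
exact: iff_sym (precedesE _ _ _ _ ij).
Qed.

Lemma represents12_avoids_111 n (g : rel 'I_n) (w : seq 'I_n) :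
  represents12 g w ->
  exists2 w', represents12 g w' & avoids [:: 1; 1; 1] (letters w').
Proof.
have [k] := ubnP (size w); elim: k w => // k IHk w ltwk gw.
have [/existsP[x]|no_triple] := boolP [exists x, subseq [:: x; x; x] w].
  case/subseq_cons_split=> [u1 [t [def_w]]].
  case/subseq_cons_split=> [u2 [v [def_t]]]; rewrite sub1seq => xv.
  apply: (IHk ((u1 ++ x :: u2) ++ v)).
    by move: ltwk; rewrite def_w def_t !size_cat /= !size_cat /= !addnS addnA.
  apply: (@represents12_delete_middle _ _ x) => //.
    by rewrite mem_cat mem_head orbT.
  by rewrite -catA cat_cons -def_t -def_w.
exists w => // /contains_111[x xxx].
by case/existsP: no_triple; exists x.
Qed.

Theorem theorem14 (T : finType) (e : rel T)
    (e_sym : symmetric e) (e_irr : irreflexive e) :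
  representable12_avoiding [:: 1; 1; 1] e <-> representable12 e.
Proof.
split=> [] [v v_bij]; first by case=> w repr_w _; exists v => //; exists w.
by case=> w /represents12_avoids_111 avoiding_w; exists v.
Qed.
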